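(* Let $n\in\omega$ and suppose $\mathrm{PH}_n$ holds. Then for every $\Omega$-system, the induced inclusion map $\bigoplus_{i\in\omega}{\lim}^n\mathbf{G}_i\to{\lim}^n\mathbf{G}$ is an isomorphism.
   Context: $\Omega$ is the set of strictly increasing functions $\omega\to\omega$. For $x,y\in\Omega$, $x\le^k y$ iff $x(i)\le y(i)$ for all $i\ge k$; $\le$ means $\le^0$; $x\le^*y$ iff $x\le^ky$ for some $k$. For $m\ge1$, $\Omega^{\le m}=\bigcup_{i=1}^m\Omega^i$; $\mathbf{x}\trianglelefteq\mathbf{y}$ means $\mathbf{x}$ is obtained from $\mathbf{y}$ by deleting coordinates; $\Omega\langle\langle m\rangle\rangle$ is the set of $\sigma=(\sigma(1),\dots,\sigma(m))$ with $\sigma(i)\in\Omega^i$ and $\sigma(1)\trianglelefteq\cdots\trianglelefteq\sigma(m)$ ($\Omega^1=\Omega$). $F:\Omega^{\le m}\to\Omega$ is $m$-cofinal if $x\le^*F(x)$ for $x\in\Omega$ and $F(\mathbf{x})\le^*F(\mathbf{y})$ whenever $\mathbf{x}\trianglelefteq\mathbf{y}$; $F^*(\sigma)=(F(\sigma(1)),\dots,F(\sigma(m)))$. $\mathrm{PH}_n$: for every $c:\Omega^{n+1}\to\omega$ there is an $(n+1)$-cofinal $F:\Omega^{\le n+1}\to\Omega$ with $c\circ F^*$ constant. An $\Omega$-system consists of finitely generated abelian groups $G_{i,k}$ ($i,k\in\omega$) and homomorphisms $\pi_{i,j,k}:G_{i,k}\to G_{i,j}$ for $j\le k$, compatible ($\pi_{i,k,k}=\mathrm{id}$,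 $\pi_{i,j,k}\pi_{i,k,l}=\pi_{i,j,l}$). For $x\in\Omega$ put $G_x=\bigoplus_{i}G_{i,x(i)}$, and for $x\le y$ let $\pi_{x,y}:G_y\to G_x$ be $\bigoplus_i\pi_{i,x(i),y(i)}$. $\mathbf{G}$ is the inverse system $(G_x,\pi_{x,y})$ over $(\Omega,\le)$, and $\mathbf{G}_i$ is the inverse system over $(\omega,\le)$ with terms $G_{i,k}$ and bonding maps $\pi_{i,j,k}$. Derived limits: for an inverse system $\mathbf{X}=(X_p,\pi_{p,q})$ over a quasi-lattice $P$ (here $(\Omega,\le)$ with meet the pointwise minimum, or $(\omega,\le)$ with $\min$), let $C^n_{\mathrm{alt}}(\mathbf{X})$ be the group of alternating $\Phi\in\prod_{(p_0,\dots,p_n)\in P^{n+1}}X_{\bigwedge_ip_i}$ (i.e. $\Phi(p_{\sigma(0)},\dots,p_{\sigma(n)})=\mathrm{sgn}(\sigma)\Phi(p_0,\dots,p_n)$ for permutations $\sigma$), with $d^n(\Phi)(\vec p)=\sum_{i=0}^{n+1}(-1)^i\pi_{\bigwedge\vec p,\bigwedge\vec p^{\,i}}(\Phi(\vec p^{\,i}))$, $\vec p^{\,i}$ being $\vec p$ with the $i$-th coordinate omitted. ${\lim}^n\mathbf{X}=\ker d^n/\mathrm{im}\,d^{n-1}$ ($d^{-1}=0$). The inclusion map is induced on cohomology by the cochain maps $C^n_{\mathrm{alt}}(\mathbf{G}_i)\to C^n_{\mathrm{alt}}(\mathbf{G})$ sending $\Phi$ to $(x_0,\dots,x_n)\mapsto\Phi(x_0(i),\dots,x_n(i))$,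 placed in the $i$-th summand of $G_{\bigwedge_jx_j}$ (these come from the inclusions of $\mathbf{G}_i$ as the $i$-th summand of $\mathbf{G}$). *)

(* Defs.v *)
From HB Require Import structures.
From mathcomp Require Import all_boot all_order all_algebra perm.
From mathcomp Require Import boolp classical_sets functions cardinality fsbigop.

Set Implicit Arguments.
Unset Strict Implicit.
Unset Printing Implicit Defensive.

Import Order.TTheory GRing.Theory Num.Theory.
Local Open Scope ring_scope.
Local Open Scope quotient_scope.

(** * Products and direct sums of abelian groups *)

Definition dprod (I : Type) (A : I -> zmodType) := forall i, A i.

Section DProd.
Variables (I : Type) (A : I -> zmodType).
Implicit Types f g h : dprod A.

HB.instance Definition _ := Choice.copy (dprod A) (forall i, A i).

Definition dprod_zero : dprod A := fun=> 0.
Definition dprod_opp f : dprod A := fun i => - f i.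
Definition dprod_add f g : dprod A := fun i => f i + g i.

Fact dprod_addA : associative dprod_add.
Proof. by move=> f g h; apply: functional_extensionality_dep => i; exact: addrA. Qed.
Fact dprod_addC : commutative dprod_add.
Proof. by move=> f g; apply: functional_extensionality_dep => i; exact: addrC. Qed.
Fact dprod_add0 : left_id dprod_zero dprod_add.
Proof. by move=> f; apply: functional_extensionality_dep => i; exact: add0r. Qed.
Fact dprod_addN : left_inverse dprod_zero dprod_opp dprod_add.
Proof. by move=> f; apply: functional_extensionality_dep => i; exact: addNr. Qed.

HB.instance Definition _ := GRing.isZmodule.Build (dprod A)
  dprod_addA dprod_addC dprod_add0 dprod_addN.

Lemma dprodP f g : (forall i, f i = g i) -> f = g.
Proof. exact: functional_extensionality_dep. Qed.

Lemma dprod0E i : (0 : dprod A) i = 0. Proof. by []. Qed.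
Lemma dprodDE f g i : (f + g) i = f i + g i. Proof. by []. Qed.
Lemma dprodNE f i : (- f) i = - f i. Proof. by []. Qed.
Lemma dprodBE f g i : (f - g) i = f i - g i. Proof. by []. Qed.

Lemma dprodMzE f (m : int) i : (f *~ m) i = f i *~ m.
Proof.
have eval_zmod : zmod_morphism (fun h : dprod A => h i) by [].
pose ev := GRing.isZmodMorphism.Build _ _ (fun h : dprod A => h i) eval_zmod.
pose evA : {additive dprod A -> A i} := HB.pack (fun h : dprod A => h i) ev.
exact: (raddfMz evA).
Qed.

Lemma dprod_sumE (J : Type) (r : seq J) (P : pred J) (F : J -> dprod A) i :
  (\sum_(j <- r | P j) F j) i = \sum_(j <- r | P j) F j i.
Proof. by elim/big_rec2: _ => // j x y _ <-. Qed.

End DProd.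

Definition finsupp (A : nat -> zmodType) : {pred dprod A} :=
  [pred f : dprod A | `[< finite_set [set i | f i != 0]%classic >]].
Arguments finsupp A : clear implicits.

Lemma finsuppP (A : nat -> zmodType) (f : dprod A) :
  reflect (finite_set [set i | f i != 0]%classic) (f \in finsupp A).
Proof. exact: asboolP. Qed.

Fact finsupp_zmod_closed (A : nat -> zmodType) : zmod_closed (finsupp A).
Proof.
split=> [|f g].
  by apply/finsuppP; apply: (sub_finite_set _ (finite_set0 nat)) => i /=; rewrite eqxx.
move=> /finsuppP ff /finsuppP fg; apply/finsuppP.
have ffg := conj ff fg; rewrite -finite_setU in ffg.
apply: (sub_finite_set _ ffg) => i /= fgi; apply/orP.
rewrite -negb_and; apply: contra fgi.
by case/andP=> /eqP fi /eqP gi; rewrite dprodBE fi gi subr0.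
Qed.

HB.instance Definition _ (A : nat -> zmodType) :=
  GRing.isZmodClosed.Build (dprod A) (finsupp A) (finsupp_zmod_closed A).

Record dsum (A : nat -> zmodType) :=
  DSum { dsum_val : dprod A; dsum_valP : dsum_val \in finsupp A }.

Definition dsum_fun (A : nat -> zmodType) (f : dsum A) : forall i, A i :=
  dsum_val f.
Coercion dsum_fun : dsum >-> Funclass.

Section DSum.
Variable A : nat -> zmodType.
HB.instance Definition _ := [isSub for @dsum_val A].
HB.instance Definition _ := [Choice of dsum A by <:].
HB.instance Definition _ := [SubChoice_isSubZmodule of dsum A by <:].

Lemma dsumP (f g : dsum A) : (forall i, f i = g i) -> f = g.
Proof. by move=> fg; apply: val_inj; apply: dprodP. Qed.

Lemma dsum0E i : (0 : dsum A) i = 0. Proof. by []. Qed.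
Lemma dsumDE (f g : dsum A) i : (f + g) i = f i + g i. Proof. by []. Qed.
Lemma dsumNE (f : dsum A) i : (- f) i = - f i. Proof. by []. Qed.
Lemma dsumBE (f g : dsum A) i : (f - g) i = f i - g i. Proof. by []. Qed.

Lemma dsumMzE (f : dsum A) (m : int) i : (f *~ m) i = f i *~ m.
Proof. by rewrite -dprodMzE -(raddfMz (val : {additive dsum A -> dprod A})). Qed.

Lemma dsum_sumE (J : Type) (r : seq J) (P : pred J) (F : J -> dsum A) i :
  (\sum_(j <- r | P j) F j) i = \sum_(j <- r | P j) F j i.
Proof. by elim/big_rec2: _ => // j x y _ <-. Qed.

Fact dsum_in_subproof i (a : A i) :
  (dfwith (fun j => 0 : A j) a : dprod A) \in finsupp A.
Proof.
apply/finsuppP; apply: (sub_finite_set _ (finite_set1 i)) => j /= nz.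
by apply/eqP; apply: contraNT nz; rewrite eq_sym => ij; rewrite dfwith_out.
Qed.

(* The inclusion of the [i]-th summand. *)
Definition dsum_in i (a : A i) : dsum A := DSum (dsum_in_subproof a).

Lemma dsum_in_id i (a : A i) : dsum_in a i = a.
Proof. exact: dfwith_in. Qed.

Lemma dsum_in_neq i j (a : A i) : i != j -> dsum_in a j = 0.
Proof. by move=> ij; rewrite /= dfwith_out. Qed.

Fact dsum_in_is_zmod_morphism i : zmod_morphism (@dsum_in i).
Proof.
move=> a b; apply: dsumP => j; rewrite dsumBE.
have [<-|ij] := eqVneq i j; first by rewrite !dsum_in_id.
by rewrite !dsum_in_neq ?subr0.
Qed.
HB.instance Definition _ i := GRing.isZmodMorphism.Build (A i) (dsum A)
  (@dsum_in i) (@dsum_in_is_zmod_morphism i).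

End DSum.

Section DSumMap.
Variables (A B : nat -> zmodType) (f : forall i, {additive A i -> B i}).

Fact dsum_map_subproof (a : dsum A) : 
  ((fun i => f i (a i)) : dprod B) \in finsupp B.
Proof.
have /finsuppP fa := dsum_valP a; apply/finsuppP.
apply: (sub_finite_set _ fa) => i /=; apply: contraNN => /eqP ai0.
by rewrite [a i]ai0 raddf0.
Qed.

Definition dsum_map (a : dsum A) : dsum B := DSum (dsum_map_subproof a).

Fact dsum_map_is_zmod_morphism : zmod_morphism dsum_map.
Proof. by move=> a b; apply: dsumP => i; exact: raddfB. Qed.
HB.instance Definition _ := GRing.isZmodMorphism.Build (dsum A) (dsum B)
  dsum_map dsum_map_is_zmod_morphism.

Lemma dsum_mapE (a : dsum A) i : dsum_map a i = f i (a i). Proof. by []. Qed.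

Lemma dsum_map_in i (a : A i) : dsum_map (dsum_in a) = dsum_in (f i a).
Proof.
apply: dsumP => j; rewrite dsum_mapE.
have [<-|ij] := eqVneq i j; first by rewrite !dsum_in_id.
by rewrite !dsum_in_neq ?raddf0.
Qed.

End DSumMap.

(** * Meets of finite families *)

Section Meets.
Variables (d : Order.disp_t) (P : meetSemilatticeType d).

(* A meet semilattice need not have a top element, so the iterated meet of the
   nonempty family [p] is started at [p ord0]; this changes nothing since
   meets are idempotent. *)
Definition meets n (p : 'I_n.+1 -> P) : P :=
  \big[Order.meet/p ord0]_(i < n.+1) p i.

Lemma meets_le n (p : 'I_n.+1 -> P) i : (meets p <= p i)%O.
Proof.
rewrite /meets; have : i \in index_enum 'I_n.+1 by rewrite mem_index_enum.
elim: (index_enum _) => // j r IHr; rewrite in_cons big_cons.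
by case/predU1P => [->|/IHr]; [exact: leIl | apply: le_trans; exact: leIr].
Qed.

Lemma le_meets n (p : 'I_n.+1 -> P) q :
  (forall i, (q <= p i)%O) -> (q <= meets p)%O.
Proof. by move=> le_q; apply: (big_ind (fun x => q <= x)%O) => // x y; rewrite lexI => -> ->. Qed.

Lemma meets_comp m n (p : 'I_n.+1 -> P) (f : 'I_m.+1 -> 'I_n.+1) :
  (meets p <= meets (p \o f))%O.
Proof. by apply: le_meets => i; exact: meets_le. Qed.

End Meets.

(** * Inverse systems of abelian groups and their derived limits *)

Record inverse_system d (P : porderType d) := InverseSystem {
  obj :> P -> zmodType;
  bond : forall p q, (p <= q)%O -> {additive obj q -> obj p};
  bond_id : forall p (pp : (p <= p)%O) a, bond pp a = a;
  bond_comp : forall p q r (pq : (p <= q)%O) (qr : (q <= r)%O) (pr : (p <= r)%O) a,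
    bond pq (bond qr a) = bond pr a }.

Section DerivedLimits.
Variables (d : Order.disp_t) (P : meetSemilatticeType d) (X : inverse_system P).

Definition cochain n := dprod (fun p : 'I_n.+1 -> P => X (meets p)).

HB.instance Definition _ n := GRing.Zmodule.on (cochain n).

(* The groups [X (meets p)] and [X (meets (p \o s))] are equal but not
   convertible; they are identified along the (identity) bonding map. *)
Definition is_alternating n (Phi : cochain n) : Prop :=
  forall (p : 'I_n.+1 -> P) (s : 'S_n.+1),
    bond X (meets_comp p s) (Phi (p \o s)) = Phi p *~ (-1) ^+ s.

Definition alternating n : {pred cochain n} :=
  [pred Phi : cochain n | `[< is_alternating Phi >]].

Lemma alternatingP n (Phi : cochain n) :
  reflect (is_alternating Phi) (Phi \in @alternating n).
Proof. exact: asboolP. Qed.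

Fact alternating_zmod_closed n : zmod_closed (@alternating n).
Proof.
split=> [|Phi Psi].
  by apply/alternatingP => p s; rewrite !dprod0E raddf0 mul0rz.
move=> /alternatingP altPhi /alternatingP altPsi; apply/alternatingP => p s.
by rewrite !dprodBE raddfB altPhi altPsi mulrzBl.
Qed.

HB.instance Definition _ n := GRing.isZmodClosed.Build (cochain n)
  (@alternating n) (@alternating_zmod_closed n).

Record alt_cochain n :=
  AltCochain { alt_val :> cochain n; alt_valP : alt_val \in @alternating n }.

HB.instance Definition _ n := [isSub for @alt_val n].
HB.instance Definition _ n := [Choice of alt_cochain n by <:].
HB.instance Definition _ n := [SubChoice_isSubZmodule of alt_cochain n by <:].

(* [p \o lift i] is the family [p] with its [i]-th entry omitted. *)
Definition cochain_diff n (Phi : cochain n) : cochain n.+1 := fun p =>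
  \sum_(i < n.+2) bond X (meets_comp p (lift i)) (Phi (p \o lift i)) *~ (-1) ^+ i.

Lemma eq_bond_cochain n (Phi : cochain n) p q r
    (h : (r <= meets p)%O) (h' : (r <= meets q)%O) :
  p = q -> bond X h (Phi p) = bond X h' (Phi q).
Proof. by move=> pq; case: q / pq h' => h'; rewrite (bool_irrelevance h h'). Qed.

Lemma cochain_diff_alternating n (Phi : cochain n) :
  is_alternating Phi -> is_alternating (cochain_diff Phi).
Proof.
move=> altPhi p s; rewrite /cochain_diff raddf_sum mulrz_suml.
rewrite [RHS](reindex_inj (@perm_inj _ s)) /=; apply: eq_bigr => i _.
have inj_si : injective (fun j : 'I_n.+1 =>
    odflt j (unlift (s i) (s (lift i j)))).
  move=> j k; case: (unliftP (s i) (s (lift i j))) => [j' Ej|/perm_inj E]; last first.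
    by have := neq_lift i j; rewrite E eqxx.
  case: (unliftP (s i) (s (lift i k))) => [k' Ek|/perm_inj E]; last first.
    by have := neq_lift i k; rewrite E eqxx.
  by move=> /= jk; move: Ej; rewrite jk -Ek => /perm_inj/lift_inj.
pose t := perm inj_si.
have Et j : s (lift i j) = lift (s i) (t j).
  rewrite permE; case: (unliftP (s i) (s (lift i j))) => [j' ->|/perm_inj E] //.
  by have := neq_lift i j; rewrite E eqxx.
have Es : s = lift_perm i (s i) t.
  apply/permP => k; case: (unliftP i k) => [j ->|->]; last by rewrite lift_perm_id.
  by rewrite lift_perm_lift Et.
have le1 : (meets p <= meets (p \o lift (s i) \o t))%O.
  exact: (meets_comp p (lift (s i) \o t)).
rewrite raddfMz (bond_comp _ _ (le_trans (meets_comp p s) (meets_comp _ _))).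
rewrite (@eq_bond_cochain _ Phi _ (p \o lift (s i) \o t) _ _ le1); last first.
  by apply/funext => j; rewrite /= Et.
rewrite -(bond_comp (meets_comp p (lift (s i))) (meets_comp _ t) le1).
rewrite altPhi raddfMz -!mulrzA; congr (_ *~ _).
have -> : odd_perm s = odd i (+) odd (s i) (+) odd_perm t.
  by rewrite [in LHS]Es odd_lift_perm.
rewrite -(signr_odd _ i) -(signr_odd _ (s i)) -!signr_addb.
by case: (odd i); case: (odd (s i)); case: (odd_perm t).
Qed.

Lemma cochain_diffK n (Phi : cochain n) : cochain_diff (cochain_diff Phi) = 0.
Proof.
apply: dprodP => p; rewrite dprod0E.
pose T (u : 'I_n.+3 * 'I_n.+2) :=
  bond X (meets_comp p (lift u.1 \o lift u.2)) (Phi (p \o (lift u.1 \o lift u.2)))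
    *~ (-1) ^+ (u.1 + u.2).
transitivity (\sum_u T u).
  rewrite -(pair_bigA _ (fun i j => T (i, j))) /=; apply: eq_bigr => i _.
  rewrite raddf_sum mulrz_suml; apply: eq_bigr => j _; rewrite raddfMz -mulrzA.
  rewrite (bond_comp _ _ (meets_comp p (lift i \o lift j))).
  by rewrite /T /= exprD mulrC.
rewrite (bigID (fun u : 'I_n.+3 * 'I_n.+2 => u.2 < u.1)%N) /=; apply/eqP; rewrite addr_eq0 -sumrN.
pose h (u : 'I_n.+3 * 'I_n.+2) : 'I_n.+3 * 'I_n.+2 := (inord u.2.+1, inord u.1).
pose k (u : 'I_n.+3 * 'I_n.+2) : 'I_n.+3 * 'I_n.+2 := (inord u.2, inord u.1.-1).
have hE : forall u : 'I_n.+3 * 'I_n.+2,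
    (u.1 <= u.2)%N -> (h u).1 = u.2.+1 :> nat /\ (h u).2 = u.1 :> nat.
  move=> u le_u; rewrite /h /= !inordK //; last exact: ltn_ord u.2.
  exact: leq_ltn_trans le_u (ltn_ord u.2).
have kE : forall u : 'I_n.+3 * 'I_n.+2,
    (u.2 < u.1)%N -> (k u).1 = u.2 :> nat /\ (k u).2 = u.1.-1 :> nat.
  move=> u lt_u; rewrite /k /= !inordK //; last exact: ltnW (ltn_ord u.2).
  by have := ltn_ord u.1; case: (nat_of_ord u.1) lt_u.
have pairP : forall u v : 'I_n.+3 * 'I_n.+2,
    u.1 = v.1 :> nat -> u.2 = v.2 :> nat -> u = v.
  by move=> [i j] [i' j'] /= /val_inj -> /val_inj ->.
clearbody h k; apply/eqP; rewrite (reindex_onto h k) /=; last first.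
  move=> u lt_u; have [k1 k2] := kE u lt_u.
  have [|h1 h2] := hE (k u); first by rewrite k1 k2 -ltnS (ltn_predK lt_u).
  by apply: pairP; rewrite ?h1 ?h2 ?k1 ?k2 // (ltn_predK lt_u).
apply: eq_big => [u|u /andP[lt_hu /eqP khu]].
  rewrite -leqNgt; apply/andP/idP => [[lt_hu /eqP khu]|le_u].
    have [k1 k2] := kE _ lt_hu; rewrite khu in k1 k2.
    by rewrite k1 k2 -ltnS (ltn_predK lt_hu).
  have [h1 h2] := hE u le_u; have lt_hu : ((h u).2 < (h u).1)%N.
    by rewrite h1 h2 ltnS.
  have [k1 k2] := kE _ lt_hu; split=> //; apply/eqP.
  by apply: pairP; rewrite ?k1 ?k2 ?h1 ?h2.
have [k1 k2] := kE _ lt_hu; rewrite khu in k1 k2.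
have h1 : (h u).1 = u.2.+1 :> nat by rewrite k2 (ltn_predK lt_hu).
have le_u : (u.1 <= u.2)%N by rewrite k1 -ltnS -h1.
have Ef : lift (h u).1 \o lift (h u).2 = lift u.1 \o lift u.2.
  apply/funext => j; apply: val_inj => /=.
  rewrite [RHS]bumpC h1 -k1; congr (bump _ (bump _ j)).
    by rewrite /bump le_u.
  by rewrite /unbump ltnNge le_u subn0.
rewrite /T -mulrNz; congr (_ *~ _); last by rewrite h1 -k1 addSn exprS mulN1r addnC.
by apply: eq_bond_cochain; rewrite Ef.
Qed.

Fact alt_diff_subproof n (Phi : alt_cochain n) :
  cochain_diff Phi \in @alternating n.+1.
Proof.
apply/alternatingP/cochain_diff_alternating.
exact/alternatingP/alt_valP.
Qed.

Definition alt_diff n (Phi : alt_cochain n) : alt_cochain n.+1 :=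
  AltCochain (alt_diff_subproof Phi).

Fact alt_diff_is_zmod_morphism n : zmod_morphism (@alt_diff n).
Proof.
move=> Phi Psi; apply: val_inj; apply: dprodP => p; rewrite [RHS]dprodBE.
rewrite /= /cochain_diff -sumrB; apply: eq_bigr => i _.
by rewrite dprodBE raddfB mulrzBl.
Qed.
HB.instance Definition _ n := GRing.isZmodMorphism.Build
  (alt_cochain n) (alt_cochain n.+1) (@alt_diff n) (@alt_diff_is_zmod_morphism n).

Lemma alt_diffK n (Phi : alt_cochain n) : alt_diff (alt_diff Phi) = 0.
Proof. by apply: val_inj; exact: cochain_diffK. Qed.

Definition cocycles n : {pred alt_cochain n} :=
  [pred Phi : alt_cochain n | alt_diff Phi == 0].

Lemma cocyclesP n (Phi : alt_cochain n) :
  reflect (alt_diff Phi = 0) (Phi \in @cocycles n).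
Proof. exact: eqP. Qed.

Fact cocycles_zmod_closed n : zmod_closed (@cocycles n).
Proof.
split=> [|Phi Psi]; first by apply/cocyclesP; rewrite raddf0.
by move=> /cocyclesP dPhi /cocyclesP dPsi; apply/cocyclesP; rewrite raddfB /= dPhi dPsi subr0.
Qed.
HB.instance Definition _ n := GRing.isZmodClosed.Build (alt_cochain n)
  (@cocycles n) (@cocycles_zmod_closed n).

Record cocycle n :=
  Cocycle { cocycle_val :> alt_cochain n; cocycle_valP : cocycle_val \in @cocycles n }.

HB.instance Definition _ n := [isSub for @cocycle_val n].
HB.instance Definition _ n := [Choice of cocycle n by <:].
HB.instance Definition _ n := [SubChoice_isSubZmodule of cocycle n by <:].

Definition is_coboundary n : alt_cochain n -> Prop :=
  match n with
  | 0 => fun Phi => Phi = 0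
  | m.+1 => fun Phi => exists Psi : alt_cochain m, Phi = alt_diff Psi
  end.

(* By [alt_diffK], this predicate on cocycles is the full image of the
   differential. *)
Definition coboundaries n : {pred cocycle n} :=
  [pred z : cocycle n | `[< is_coboundary z >]].

Lemma coboundariesP n (z : cocycle n) :
  reflect (is_coboundary z) (z \in @coboundaries n).
Proof. exact: asboolP. Qed.

Fact coboundaries_zmod_closed n : zmod_closed (@coboundaries n).
Proof.
split=> [|y z].
  by apply/coboundariesP; case: n => [//|n]; exists 0; rewrite raddf0.
move=> /coboundariesP By /coboundariesP Bz; apply/coboundariesP.
case: n y z By Bz => [|n] y z /= => [-> ->|[Psi ->] [Psi' ->]].
  by rewrite subr0.
by exists (Psi - Psi'); rewrite raddfB.
Qed.
HB.instance Definition _ n := GRing.isZmodClosed.Build (cocycle n)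
  (@coboundaries n) (@coboundaries_zmod_closed n).

Definition derlim n : zmodType := Quotient.quot (@coboundaries n).

Definition derlim_class n (z : cocycle n) : derlim n :=
  \pi_(Quotient.quot (@coboundaries n)) z.

Fact derlim_class_is_zmod_morphism n : zmod_morphism (@derlim_class n).
Proof. by move=> y z; rewrite /derlim_class raddfB. Qed.
HB.instance Definition _ n := GRing.isZmodMorphism.Build
  (cocycle n) (derlim n) (@derlim_class n) (@derlim_class_is_zmod_morphism n).

Lemma derlim_class_eqP n (y z : cocycle n) :
  reflect (derlim_class y = derlim_class z) (y - z \in @coboundaries n).
Proof. by rewrite Quotient.idealrBE; exact: eqP. Qed.

Definition derlim_repr n (u : derlim n) : cocycle n :=
  repr (u : Quotient.quot (@coboundaries n)).

Lemma derlim_reprK n : cancel (@derlim_repr n) (@derlim_class n).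
Proof. exact: reprK. Qed.

End DerivedLimits.

(** * The poset of strictly increasing functions *)

Definition strictly_increasing : {pred nat -> nat} :=
  [pred x : nat -> nat | `[< forall i j, (i < j)%N -> (x i < x j)%N >]].

Lemma strictly_increasingP (x : nat -> nat) :
  reflect (forall i j, (i < j)%N -> (x i < x j)%N) (x \in strictly_increasing).
Proof. exact: asboolP. Qed.

Record Omega := MkOmega {
  omega_fun :> nat -> nat;
  omega_incr : omega_fun \in strictly_increasing }.

Fact nat_meetE (a b : nat) : (a `&` b)%O = minn a b.
Proof. by rewrite meetEtotal minEnat. Qed.

Fact nat_joinE (a b : nat) : (a `|` b)%O = maxn a b.
Proof. by rewrite joinEtotal maxEnat. Qed.

Fact strictly_increasing_meet : meet_closed strictly_increasing.
Proof.
move=> x y /strictly_increasingP xi /strictly_increasingP yi.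
apply/strictly_increasingP => i j ij; rewrite !meetfE !nat_meetE.
by rewrite leq_min !gtn_min xi // yi // orbT.
Qed.

Fact strictly_increasing_join : join_closed strictly_increasing.
Proof.
move=> x y /strictly_increasingP xi /strictly_increasingP yi.
apply/strictly_increasingP => i j ij; rewrite !joinfE !nat_joinE.
by rewrite gtn_max !leq_max xi // yi // orbT.
Qed.

HB.instance Definition _ := [isSub for omega_fun].
HB.instance Definition _ := [Choice of Omega by <:].
(* The order induced by the pointwise order on [nat -> nat]; meets are
   pointwise minima. *)
HB.instance Definition _ := Order.SubChoice_isSubLattice.Build _
  (nat -> nat) strictly_increasing FunOrder.fun_display Omega
  strictly_increasing_meet strictly_increasing_join.

Lemma Omega_le_at (x y : Omega) : (x <= y)%O -> forall i, (x i <= y i)%O.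
Proof. by move=> /lefP. Qed.

Lemma Omega_leP (x y : Omega) : reflect (forall i, (x i <= y i)%N) (x <= y)%O.
Proof. exact: (lefP (omega_fun x) (omega_fun y)). Qed.

Lemma Omega_meetE (x y : Omega) i : (x `&` y)%O i = minn (x i) (y i).
Proof. exact: nat_meetE. Qed.

Definition le_from (k : nat) (x y : Omega) := forall i, (k <= i)%N -> (x i <= y i)%N.

Definition le_star (x y : Omega) := exists k, le_from k x y.

(** * The partition hypothesis *)

(* Nonempty tuples of length at most [m]. *)
Record Omega_upto (m : nat) := OmegaUpto {
  upto_seq :> seq Omega;
  upto_size : (0 < size upto_seq <= m)%N }.

(* The set [Omega<<m>>] of [(sigma(1), ..., sigma(m))]; ordinals start at 0, so
   [sigma(i+1)], a tuple of length [i+1], is [chain_at i]. *)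
Record Omega_chain (m : nat) := OmegaChain {
  chain_at :> 'I_m -> Omega_upto m;
  chain_size : forall i, size (chain_at i) = i.+1;
  chain_subseq : forall i j : 'I_m, j = i.+1 :> nat ->
    subseq (chain_at i) (chain_at j) }.

Fact upto1_subproof m (x : Omega) : (0 < size [:: x] <= m.+1)%N.
Proof. by []. Qed.

Definition upto1 m (x : Omega) : Omega_upto m.+1 := OmegaUpto (upto1_subproof m x).

(* [F] is [m.+1]-cofinal. Deletion of (possibly no) coordinates is [subseq]. *)
Definition cofinal m (F : Omega_upto m.+1 -> Omega) : Prop :=
  (forall x : Omega, le_star x (F (upto1 m x))) /\
  (forall s t : Omega_upto m.+1, subseq s t -> le_star (F s) (F t)).

Definition star m (F : Omega_upto m -> Omega) (sigma : Omega_chain m) :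
    'I_m -> Omega :=
  fun i => F (sigma i).

Definition PH (n : nat) : Prop :=
  forall c : ('I_n.+1 -> Omega) -> nat,
  exists2 F : Omega_upto n.+1 -> Omega, cofinal F &
    exists k, forall sigma : Omega_chain n.+1, c (star F sigma) = k.

(** * Omega-systems *)

Definition finitely_generated (A : zmodType) : Prop :=
  exists s : seq A, forall a : A, exists c : nat -> int,
    a = \sum_(i < size s) s`_i *~ c i.

(* [G i] is the inverse system over the naturals with terms [G i k]. *)
Record Omega_system := OmegaSystem {
  component :> nat -> inverse_system nat;
  component_fg : forall i k, finitely_generated (component i k) }.

Section OmegaSystem.
Variable G : Omega_system.

Definition sum_obj (x : Omega) : zmodType := dsum (fun i => G i (x i)).

Definition sum_bond (x y : Omega) (xy : (x <= y)%O) :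
    {additive sum_obj y -> sum_obj x} :=
  dsum_map (fun i => bond (G i) (Omega_le_at xy i)).

Fact sum_bond_id x (xx : (x <= x)%O) a : sum_bond xx a = a.
Proof. by apply: dsumP => i; exact: bond_id. Qed.

Fact sum_bond_comp x y z (xy : (x <= y)%O) (yz : (y <= z)%O) (xz : (x <= z)%O) a :
  sum_bond xy (sum_bond yz a) = sum_bond xz a.
Proof. by apply: dsumP => i; exact: bond_comp. Qed.

Definition sum_system : inverse_system Omega :=
  InverseSystem sum_bond_id sum_bond_comp.

(* The family [j |-> x_j(i)]. *)
Definition at_coord n (x : 'I_n.+1 -> Omega) (i : nat) : 'I_n.+1 -> nat :=
  fun j => x j i.

Lemma meets_at_coord n (x : 'I_n.+1 -> Omega) i :
  (meets x i <= meets (at_coord x i))%O.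
Proof. by apply: le_meets => j; exact: Omega_le_at (meets_le x j) i. Qed.

Lemma meets_at_coordE n (x : 'I_n.+1 -> Omega) i :
  meets x i = meets (at_coord x i).
Proof.
by apply: (big_rec2 (fun (y : Omega) (z : nat) => y i = z)) => // j y z _ <-.
Qed.

(* By [meets_at_coordE] the bonding map merely identifies two equal groups. *)
Definition incl_cochain i n (Phi : cochain (G i) n) : cochain sum_system n :=
  fun x => @dsum_in (fun i => G i (meets x i)) i
    (bond (G i) (meets_at_coord x i) (Phi (at_coord x i))).

Lemma incl_cochain_alternating i n (Phi : cochain (G i) n) :
  is_alternating Phi -> is_alternating (incl_cochain Phi).
Proof.
move=> altPhi x s; rewrite [LHS]dsum_map_in -raddfMz; congr dsum_in.
rewrite -raddfMz -altPhi.
have le1 : (meets x i <= meets (at_coord x i \o s))%O.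
  exact: le_trans (meets_at_coord x i) (meets_comp _ s).
by rewrite (bond_comp _ _ le1) (bond_comp _ _ le1).
Qed.

Fact incl_alt_subproof i n (Phi : alt_cochain (G i) n) :
  incl_cochain Phi \in @alternating _ _ sum_system n.
Proof.
by apply/alternatingP/incl_cochain_alternating/alternatingP/alt_valP.
Qed.

Definition incl_alt i n (Phi : alt_cochain (G i) n) : alt_cochain sum_system n :=
  AltCochain (incl_alt_subproof Phi).

Fact incl_alt_is_zmod_morphism i n : zmod_morphism (@incl_alt i n).
Proof.
move=> Phi Psi; apply: val_inj; apply: dprodP => x; rewrite [RHS]dprodBE.
by rewrite /= /incl_cochain -raddfB; congr dsum_in; rewrite -raddfB.
Qed.
HB.instance Definition _ i n := GRing.isZmodMorphism.Build
  (alt_cochain (G i) n) (alt_cochain sum_system n)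
  (@incl_alt i n) (@incl_alt_is_zmod_morphism i n).

Lemma incl_alt_diff i n (Phi : alt_cochain (G i) n) :
  alt_diff (incl_alt Phi) = incl_alt (alt_diff Phi).
Proof.
apply: val_inj; apply: dprodP => x /=.
rewrite /cochain_diff /incl_cochain raddf_sum raddf_sum; apply: eq_bigr => j _.
rewrite [X in X *~ _]dsum_map_in !raddfMz /=; congr (dsum_in _ *~ _).
have le1 : (meets x i <= meets (at_coord x i \o lift j))%O.
  exact: le_trans (meets_at_coord x i) (meets_comp _ (lift j)).
by rewrite (bond_comp _ _ le1) (bond_comp _ _ le1).
Qed.

Fact incl_cocycle_subproof i n (z : cocycle (G i) n) :
  incl_alt z \in @cocycles _ _ sum_system n.
Proof.
by apply/cocyclesP; rewrite incl_alt_diff (cocyclesP _ (cocycle_valP z)) raddf0.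
Qed.

Definition incl_cocycle i n (z : cocycle (G i) n) : cocycle sum_system n :=
  Cocycle (incl_cocycle_subproof z).

Fact incl_cocycle_is_zmod_morphism i n : zmod_morphism (@incl_cocycle i n).
Proof. by move=> y z; apply: val_inj; rewrite /= raddfB. Qed.
HB.instance Definition _ i n := GRing.isZmodMorphism.Build
  (cocycle (G i) n) (cocycle sum_system n)
  (@incl_cocycle i n) (@incl_cocycle_is_zmod_morphism i n).

Lemma incl_cocycle_coboundary i n (z : cocycle (G i) n) :
  z \in @coboundaries _ _ (G i) n ->
  incl_cocycle z \in @coboundaries _ _ sum_system n.
Proof.
move=> /coboundariesP Bz; apply/coboundariesP.
case: n z Bz => [|n] z /= => [->|[Psi ->]]; first exact: raddf0.
by exists (incl_alt Psi); rewrite incl_alt_diff.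
Qed.

Definition incl_derlim i n (u : derlim (G i) n) : derlim sum_system n :=
  derlim_class (incl_cocycle (derlim_repr u)).

(* [incl_derlim] does not depend on the chosen representatives. *)
Lemma incl_derlim_class i n (z : cocycle (G i) n) :
  incl_derlim (derlim_class z) = derlim_class (incl_cocycle z).
Proof.
apply/derlim_class_eqP; rewrite -raddfB; apply: incl_cocycle_coboundary.
by apply/derlim_class_eqP; rewrite derlim_reprK.
Qed.

Fact incl_derlim_is_zmod_morphism i n : zmod_morphism (@incl_derlim i n).
Proof.
move=> u v; rewrite -(derlim_reprK u) -(derlim_reprK v) -raddfB.
by rewrite !incl_derlim_class !raddfB.
Qed.
HB.instance Definition _ i n := GRing.isZmodMorphism.Build
  (derlim (G i) n) (derlim sum_system n)
  (@incl_derlim i n) (@incl_derlim_is_zmod_morphism i n).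

(* A sum with finitely many nonzero terms, [u] having finite support. *)
Definition inclusion_map n (u : dsum (fun i => derlim (G i) n)) :
    derlim sum_system n :=
  \sum_(i \in [set: nat]) incl_derlim (u i).

Lemma inclusion_map_widen n (u : dsum (fun i => derlim (G i) n)) (D : set nat) :
  finite_set D -> (forall i, u i != 0 -> D i) ->
  inclusion_map u = \sum_(i \in D) incl_derlim (u i).
Proof.
move=> finD uD; apply/esym/fsbig_widen => // i [_ /= Di].
by have [->|/uD //] := eqVneq (u i) 0; exact: raddf0.
Qed.

Fact inclusion_map_is_zmod_morphism n : zmod_morphism (@inclusion_map n).
Proof.
move=> u v.
have fin := conj (finsuppP _ (dsum_valP u)) (finsuppP _ (dsum_valP v)).
rewrite -finite_setU in fin; set D := (_ `|` _)%classic in fin.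
have uD i : u i != 0 -> D i by left.
have vD i : v i != 0 -> D i by right.
have uvD i : (u - v) i != 0 -> D i.
  move=> uv; apply/orP; rewrite -negb_and; apply: contra uv.
  by case/andP=> /eqP ui /eqP vi; rewrite dsumBE [u i]ui [v i]vi subr0.
rewrite !(@inclusion_map_widen _ _ D) //.
apply/eqP; rewrite eq_sym subr_eq -fsbig_split //; apply/eqP.
by apply: eq_fsbigr => i _; rewrite dsumBE raddfB /= subrK.
Qed.
HB.instance Definition _ n := GRing.isZmodMorphism.Build
  (dsum (fun i => derlim (G i) n)) (derlim sum_system n)
  (@inclusion_map n) (@inclusion_map_is_zmod_morphism n).

Lemma inclusion_map_in n i (u : derlim (G i) n) :
  inclusion_map (@dsum_in (fun i => derlim (G i) n) i u) = incl_derlim u.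
Proof.
rewrite (@inclusion_map_widen _ _ [set i]%classic) //; last first.
  by move=> j; have [<- _|ij] := eqVneq i j; rewrite ?dsum_in_neq ?eqxx.
by rewrite fsbig_set1 dsum_in_id.
Qed.

End OmegaSystem.

(* Main.v *)
(** Injectivity: pull a primitive on [Omega] back along increasing functions
    [bump_from i k] whose value at [i] is [max k i].  Surjectivity: a cocycle
    [Phi] is compared with its barycentric subdivision, where the barycenter of
    a tuple is chosen separately at each coordinate.  PH, applied to the
    colouring that bounds the support of [Phi] and the stage from which a tuple
    is increasing, yields a function [F] and a single [N] such that beyond [N]
    the values of [F] dominate their arguments, as the homotopy requires, while
    [Phi] vanishes on the tuples [F*(sigma)] forming the subdivision.  At the
    coordinates [i < N] the barycenters are values of [bump_from i], on which
    [Phi] agrees with the cocycle restricted to [G i].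

    The derived limits allow 2-torsion values at tuples with repetitions, so
    homotopies must preserve alternation literally.  This is why the barycenters
    are required to be symmetric functions of the tuple. *)
From Pilot Require Import Defs.
From HB Require Import structures.
From mathcomp Require Import all_boot all_order all_algebra perm.
From mathcomp Require Import boolp classical_sets cardinality fsbigop.
From mathcomp Require Import zify.
Set Implicit Arguments.
Unset Strict Implicit.
Unset Printing Implicit Defensive.

Import Order.TTheory GRing.Theory Num.Theory.
(* [meets] and [le_meets] are shadowed by library names. *)
Import Pilot.Defs.
Local Open Scope ring_scope.

(** * Barycentric subdivision of functions on tuples *)

Section Tuples.
Variable T : Type.

Definition fcons k (a : T) (x : 'I_k -> T) : 'I_k.+1 -> T :=
  fun i => if unlift ord0 i is Some j then x j else a.

Lemma fcons_lift0 k a (x : 'I_k -> T) : fcons a x \o lift ord0 = x.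
Proof. by apply/funext => j; rewrite /fcons /= liftK. Qed.

Lemma fcons_lift k a (x : 'I_k.+1 -> T) j :
  fcons a x \o lift (lift ord0 j) = fcons a (x \o lift j).
Proof.
apply/funext => i; rewrite /fcons /=.
case: (unliftP ord0 i) => [i' ->|->].
  have -> : lift (lift ord0 j) (lift ord0 i') = lift ord0 (lift j i').
    by apply: val_inj; rewrite /= /bump /= !add1n ltnS addnS.
  by rewrite liftK.
have -> : lift (lift ord0 j) (ord0 : 'I_k.+1) = ord0 by apply: val_inj.
by rewrite unlift_none.
Qed.

Lemma fcons_perm k a (x : 'I_k -> T) (s : 'S_k) :
  fcons a (x \o s) = fcons a x \o lift_perm ord0 ord0 s.
Proof.
apply/funext => i; rewrite /fcons /=.
case: (unliftP ord0 i) => [i' ->|->]; first by rewrite lift_perm_lift liftK.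
by rewrite lift_perm_id unlift_none.
Qed.

Definition all_in k (S : T -> Prop) (x : 'I_k -> T) := forall j, S (x j).

Lemma all_in_fcons k (S : T -> Prop) a (x : 'I_k -> T) :
  S a -> all_in S x -> all_in S (fcons a x).
Proof. by move=> Sa Sx i; rewrite /fcons; case: unlift. Qed.

Section Difference.
Variable A : zmodType.
Implicit Types k : nat.

Definition diff k (f : ('I_k -> T) -> A) (t : 'I_k.+1 -> T) : A :=
  \sum_(i < k.+1) f (t \o lift i) *~ (-1) ^+ i.

Definition alternates k (f : ('I_k -> T) -> A) :=
  forall x (s : 'S_k), f (x \o s) = f x *~ (-1) ^+ s.

Lemma diffB k (f g : ('I_k -> T) -> A) t :
  diff (fun x => f x - g x) t = diff f t - diff g t.
Proof. by rewrite /diff -sumrB; apply: eq_bigr => i _; rewrite mulrzBl. Qed.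

Lemma diff0 k t : diff (fun _ : 'I_k -> T => 0) t = 0.
Proof. by rewrite /diff big1 // => i _; rewrite mul0rz. Qed.

(** The boundary formula for a cone, [d (a x) = x - a (d x)], dualized to functions. *)
Lemma diff_fcons k (f : ('I_k.+1 -> T) -> A) a x :
  diff f (fcons a x) = f x - diff (f \o fcons a) x.
Proof.
rewrite /diff big_ord_recl /= fcons_lift0 expr0 mulr1z; congr (_ + _).
rewrite -sumrN; apply: eq_bigr => j _.
by rewrite fcons_lift -mulrNz exprS mulN1r.
Qed.

End Difference.
End Tuples.

Section ConstantSystem.
Variables (d : Order.disp_t) (T : meetSemilatticeType d) (A : zmodType).

(** Functions into a fixed group are cochains of this system, so [diff] inherits what is known of
    [cochain_diff] on nonempty tuples. *)
Definition const_system : inverse_system T :=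
  @InverseSystem d T (fun=> A) (fun _ _ _ => idfun) (fun _ _ _ => erefl)
    (fun _ _ _ _ _ _ _ => erefl).

Lemma diff_diff k (f : ('I_k -> T) -> A) t : diff (diff f) t = 0.
Proof.
case: k f t => [|k] f t; last first.
  exact: (congr1 (fun g : cochain const_system k.+2 => g t)
    (@cochain_diffK d T const_system k f)).
(* In the augmented degree both terms are the value of [f] at the empty tuple, with opposite
   signs. *)
rewrite /diff !big_ord_recl !big_ord0 !addr0 /= expr1 expr0 !mulr1z addrC.
have fE (u v : 'I_0 -> T) : f u = f v by congr f; apply/funext => -[].
by apply/eqP; rewrite mulrNz mulr1z addrC subr_eq0; apply/eqP; exact: fE.
Qed.

Lemma diff_alternates k (f : ('I_k.+1 -> T) -> A) :
  alternates f -> alternates (diff f).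
Proof. exact: (@cochain_diff_alternating d T const_system k f). Qed.

End ConstantSystem.

Section Subdivision.
Variables (d : Order.disp_t) (T : meetSemilatticeType d).
Variable b : forall k, ('I_k.+1 -> T) -> T.

Section Operators.
Variable A : zmodType.

(* [prism] evaluates [f] on Hatcher's chain homotopy [T x = b_x (x - T dx)],
   where [b x] plays the role of the barycenter, and [subdiv] on the subdivided
   simplex [S x = b_x (S dx)].  The complexes are augmented: a tuple of length
   [k] has degree [k - 1]. *)
Fixpoint prism k : (('I_k.+1 -> T) -> A) -> ('I_k -> T) -> A :=
  match k with
  | 0 => fun _ _ => 0
  | k.+1 => fun f x =>
      f (fcons (b x) x) - diff (prism (f \o fcons (b x))) x
  end.

Fixpoint subdiv k : (('I_k -> T) -> A) -> ('I_k -> T) -> A :=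
  match k with
  | 0 => fun f x => f x
  | k.+1 => fun f x => diff (subdiv (f \o fcons (b x))) x
  end.

Lemma prismS k (f : ('I_k.+2 -> T) -> A) x :
  prism f x = f (fcons (b x) x) - diff (prism (f \o fcons (b x))) x.
Proof. by []. Qed.

Lemma prismB k (f g : ('I_k.+1 -> T) -> A) x :
  prism (fun t => f t - g t) x = prism f x - prism g x.
Proof.
elim: k f g x => [|k IHk] f g x /=; first by rewrite subr0.
have -> : prism ((fun t => f t - g t) \o fcons (b x)) =
    fun y => prism (f \o fcons (b x)) y - prism (g \o fcons (b x)) y.
  by apply/funext => y; rewrite -IHk.
by rewrite diffB !opprD !opprK !addrA; congr (_ + _); rewrite addrAC.
Qed.

(** Dual to [dT + Td = 1 - S]. The apex [b x] is held fixed, the cone formula rewrites [diff f] on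
    the cone, induction applies to [f \o fcons (b x)], and [diff_diff] removes the remaining
    term. *)
Lemma prism_homotopy k (f : ('I_k.+1 -> T) -> A) x :
  prism (diff f) x + diff (prism f) x = f x - subdiv f x.
Proof.
elim: k f x => [|k IHk] f x.
  by rewrite /= diff_fcons !diff0 subr0 addr0.
rewrite prismS.
have -> : diff f \o fcons (b x) = fun t => f t - diff (f \o fcons (b x)) t.
  by apply/funext => t; rewrite /= diff_fcons.
have -> : prism (fun t => f t - diff (f \o fcons (b x)) t) = fun y =>
      prism f y - ((f \o fcons (b x)) y - subdiv (f \o fcons (b x)) y -
            diff (prism (f \o fcons (b x))) y).
  by apply/funext => y; rewrite prismB -IHk addrK.
move: (prism f) (prism (f \o fcons (b x))) => P Q.
rewrite !diffB diff_diff diff_fcons subr0 opprB addrA subrK addrA subrK.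
by [].
Qed.

(** As [b] is symmetric, permuting [x] fixes the apex, and the permutation lifted to the cone has
    the same sign. *)
Lemma prism_alternates k (f : ('I_k.+1 -> T) -> A) :
  (forall m (x : 'I_m.+1 -> T) (s : 'S_m.+1), b (x \o s) = b x) ->
  alternates f -> alternates (prism f).
Proof.
move=> b_sym; elim: k f => [|k IHk] f altf x s; first by rewrite /= mul0rz.
have altfb : alternates (f \o fcons (b x)).
  by move=> y t; rewrite /= fcons_perm altf odd_lift_perm.
rewrite /= b_sym fcons_perm altf odd_lift_perm /= mulrzBl; congr (_ - _).
case: k IHk f altf x s altfb => [|k] IHk f altf x s altfb; last first.
  exact/diff_alternates/IHk.
by rewrite !diff0 mul0rz.
Qed.

Definition closed_under (S : T -> Prop) :=
  forall k (x : 'I_k.+1 -> T), all_in S x -> S (b x).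

(** The tuples visited by [prism] consist of entries of [x] and barycenters of its faces, all of
    which stay in [S]. *)
Lemma prism_ext (S : T -> Prop) k (f g : ('I_k.+1 -> T) -> A) x :
  closed_under S -> (forall t, all_in S t -> f t = g t) -> all_in S x ->
  prism f x = prism g x.
Proof.
move=> Sb; elim: k f g x => [|k IHk] f g x fg Sx //=.
have Sbx := Sb _ _ Sx.
rewrite fg; last exact: all_in_fcons.
congr (_ - _); apply: eq_bigr => i _; congr (_ *~ _).
apply: IHk => [t St|j]; last exact: Sx.
by apply: fg; exact: all_in_fcons.
Qed.

Lemma prism_eq0 (S : T -> Prop) k (f : ('I_k.+1 -> T) -> A) x :
  closed_under S -> (forall t, all_in S t -> f t = 0) -> all_in S x ->
  prism f x = 0.
Proof.
move=> Sb f0 Sx; rewrite (prism_ext Sb f0 Sx).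
have := prismB (fun=> 0) (fun=> 0) x.
by rewrite !subrr.
Qed.

(* [barycentric x t]: [t] is one of the tuples that occur in [subdiv]. *)
Fixpoint barycentric k : ('I_k -> T) -> ('I_k -> T) -> Prop :=
  match k with
  | 0 => fun _ _ => True
  | k.+1 => fun x t => exists (j : 'I_k.+1) (u : 'I_k -> T),
      barycentric (x \o lift j) u /\ t = fcons (b x) u
  end.

Lemma subdiv_eq0 k (f : ('I_k -> T) -> A) x :
  (forall t, barycentric x t -> f t = 0) -> subdiv f x = 0.
Proof.
elim: k f x => [|k IHk] f x f0; first exact: f0.
rewrite /= /diff big1 // => i _; rewrite IHk ?mul0rz // => t xt.
by apply: f0; exists i, t.
Qed.

Lemma barycentric_in (B : T -> Prop) k (x t : 'I_k -> T) :
  (forall m (y : 'I_m.+1 -> T), B (b y)) -> barycentric x t -> all_in B t.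
Proof.
move=> Bb; elim: k x t => [|k IHk] x t /=; first by move=> _ [].
by move=> [j [u [xu ->]]]; apply: all_in_fcons => //; exact: IHk xu.
Qed.

End Operators.

Lemma raddf_prism (A B : zmodType) (h : {additive A -> B}) k
    (f : ('I_k.+1 -> T) -> A) x : h (prism f x) = prism (h \o f) x.
Proof.
elim: k f x => [|k IHk] f x /=; first exact: raddf0.
rewrite raddfB /diff raddf_sum; congr (_ - _); apply: eq_bigr => i _.
by rewrite raddfMz IHk.
Qed.

(** With [b] independent of [i], the same finitely many tuples are visited for all [i], so a maximum
    of thresholds suffices. *)
Lemma prism_eventually0 (A : nat -> zmodType) k
    (f : forall i, ('I_k.+1 -> T) -> A i) (x : 'I_k -> T) :
  (forall t, exists K, forall i, (K <= i)%N -> f i t = 0) ->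
  exists K, forall i, (K <= i)%N -> prism (f i) x = 0.
Proof.
elim: k f x => [|k IHk] f x f0; first by exists 0.
have [K0 fK0] := f0 (fcons (b x) x).
have /choice [K fK] : forall j : 'I_k.+1, exists K, forall i, (K <= i)%N ->
    prism (f i \o fcons (b x)) (x \o lift j) = 0.
  by move=> j; apply: IHk => t; exact: f0.
exists (maxn K0 (\max_j K j)) => i; rewrite geq_max => /andP[le0 leK].
rewrite /= fK0 // sub0r /diff big1 ?oppr0 // => j _; rewrite fK ?mul0rz //.
exact: leq_trans (leq_bigmax j) leK.
Qed.

End Subdivision.

(** * Primitives of cocycles that vanish on subdivisions *)

Section Push.
Variables (d : Order.disp_t) (P : porderType d) (X : inverse_system P).
Implicit Types k l m : P.

(* The junk value [0] when [m <= k] fails makes this a total function. *)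
Definition push m k (a : X k) : X m :=
  if decP (@idP (m <= k)%O) is left mk then bond X mk a else 0.

Lemma pushE m k (mk : (m <= k)%O) (a : X k) : push m a = bond X mk a.
Proof.
rewrite /push; case: decP => [mk'|nmk]; last by case: nmk.
by rewrite (bool_irrelevance mk' mk).
Qed.

Lemma push_out m k (a : X k) : ~~ (m <= k)%O -> push m a = 0.
Proof. by move=> /negP nmk; rewrite /push; case: decP. Qed.

Fact push_is_zmod_morphism m k : zmod_morphism (@push m k).
Proof.
by move=> a a'; rewrite /push; case: decP => ?; [exact: raddfB | rewrite subr0].
Qed.
HB.instance Definition _ m k := GRing.isZmodMorphism.Build (X k) (X m)
  (@push m k) (@push_is_zmod_morphism m k).

Lemma push_id k (a : X k) : push k a = a.
Proof. by rewrite (pushE (lexx k)) bond_id. Qed.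

Lemma push_bond m k l (kl : (k <= l)%O) (a : X l) :
  (m <= k)%O -> push m (bond X kl a) = push m a.
Proof.
by move=> mk; rewrite (pushE mk) (pushE (le_trans mk kl)); exact: bond_comp.
Qed.

Lemma push_push m k l (a : X l) :
  (m <= k)%O -> (k <= l)%O -> push m (push k a) = push m a.
Proof. by move=> mk kl; rewrite (pushE kl) push_bond. Qed.

End Push.

(* Each [phi y] lives in a group depending on [y].  Pushing all of them into the
   group at a fixed level [m] makes [prism] applicable; it only evaluates at
   tuples whose entries stay above [m], where no information is lost. *)
Section LocalPrism.
Variables (d d' : Order.disp_t) (T : meetSemilatticeType d) (P : porderType d').
Variables (X : inverse_system P) (lam : T -> P).
Variable mu : forall k, ('I_k.+1 -> T) -> P.
Hypothesis le_mu : forall k (y : 'I_k.+1 -> T) m,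
  (m <= mu y)%O <-> all_in (fun t => m <= lam t)%O y.
Variable b : forall k, ('I_k.+1 -> T) -> T.
Hypothesis le_b : forall k (y : 'I_k.+1 -> T), (mu y <= lam (b y))%O.
Variables (n : nat) (phi : forall y : 'I_n.+1 -> T, X (mu y)).

Definition eval_at m (y : 'I_n.+1 -> T) : X m := push m (phi y).

Definition local_prism m (x : 'I_n -> T) : X m := prism b (eval_at m) x.

Lemma closed_under_le m : closed_under b (fun t => m <= lam t)%O.
Proof. by move=> k x /le_mu mx; exact: le_trans mx (le_b x). Qed.

(** All entries visited lie above [l], so every value of [phi] involved passes through level [l] on
    its way to [m]. *)
Lemma push_local_prism m l (x : 'I_n -> T) : (m <= l)%O ->
  all_in (fun t => l <= lam t)%O x ->
  push m (local_prism l x) = local_prism m x.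
Proof.
move=> ml lx; rewrite /local_prism raddf_prism.
apply: (prism_ext (closed_under_le (m := l))) => // t /le_mu lt.
by rewrite /= /eval_at push_push.
Qed.

Lemma local_prism_alternates m :
  (forall k (x : 'I_k.+1 -> T) (s : 'S_k.+1), b (x \o s) = b x) ->
  (forall y (s : 'S_n.+1), (m <= mu y)%O ->
     push m (phi (y \o s)) = push m (phi y *~ (-1) ^+ s)) ->
  alternates (local_prism m).
Proof.
move=> b_sym altphi; apply: prism_alternates => // y s.
rewrite /eval_at; have [my|my] := boolP (m <= mu y)%O.
  by rewrite altphi // raddfMz.
(* Whether [m <= mu y] holds is invariant under permutation, so both sides are the default value
   0. *)
rewrite !push_out ?mul0rz //; apply: contra my => /le_mu mys.
by apply/le_mu => j; have := mys (s^-1%g j); rewrite /= permKV.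
Qed.

(** In the homotopy identity the prism of the differential and the subdivision both vanish. *)
Lemma local_prism_diff m (x : 'I_n.+1 -> T) :
  (forall y, (m <= mu y)%O -> diff (eval_at m) y = 0) ->
  (forall t, barycentric b x t -> phi t = 0) ->
  (m <= mu x)%O -> diff (local_prism m) x = eval_at m x.
Proof.
move=> dphi phi0 /le_mu mx; have := prism_homotopy b (eval_at m) x.
rewrite (prism_eq0 (closed_under_le (m := m)) _ mx) => [|t /le_mu]; last exact: dphi.
by rewrite add0r subdiv_eq0 ?subr0 // => t /phi0; rewrite /eval_at => ->; exact: raddf0.
Qed.

End LocalPrism.

Lemma le_meetsP d (P : meetSemilatticeType d) k (y : 'I_k.+1 -> P) m :
  (m <= meets y)%O <-> all_in (fun t => m <= t)%O y.
Proof.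
split=> [my j|]; first exact: le_trans my (meets_le y j).
by move=> my; apply: le_meets => j; exact: my.
Qed.

Section SystemPrism.
Variables (d : Order.disp_t) (P : meetSemilatticeType d) (X : inverse_system P).
Variable b : forall k, ('I_k.+1 -> P) -> P.
Hypothesis b_sym : forall k (x : 'I_k.+1 -> P) (s : 'S_k.+1), b (x \o s) = b x.
Hypothesis le_b : forall k (y : 'I_k.+1 -> P), (meets y <= b y)%O.

Lemma coboundary_of_subdiv n (Phi : alt_cochain X n) : alt_diff Phi = 0 ->
  (forall x t, barycentric b x t -> alt_val Phi t = 0) -> is_coboundary Phi.
Proof.
move=> dPhi Phi0.
pose psi m := @local_prism _ _ P P X (@meets _ P) b n (alt_val Phi) m.
have psiE m x : (m <= meets x)%O -> diff (psi m) x = push m (alt_val Phi x).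
  apply: (@local_prism_diff _ _ _ _ _ id _ (@le_meetsP _ P) _ le_b) => [y my|t].
    transitivity (push m (alt_val (alt_diff Phi) y)); last by rewrite dPhi raddf0.
    rewrite raddf_sum; apply: eq_bigr => i _.
    by rewrite raddfMz /= push_bond.
  exact: Phi0.
have psi_alt m : alternates (psi m).
  apply: (@local_prism_alternates _ _ _ _ _ id _ (@le_meetsP _ P)) => // y s my.
  have /alternatingP/(_ y s) <- := alt_valP Phi.
  by rewrite push_bond.
have psi_push m l x : (m <= l)%O -> all_in (fun t => l <= t)%O x ->
    push m (psi l x) = psi m x.
  exact: (@push_local_prism _ _ _ _ _ id _ (@le_meetsP _ P) _ le_b).
(* A coboundary of degree 0 has to be zero. There [prism] is zero on the empty tuple, so [psiE]
   forces [Phi = 0]. *)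
have psi0 m x : n = 0%N -> psi m x = 0 by move=> n0; subst n.
clearbody psi; case: n Phi dPhi Phi0 psi psiE psi_alt psi_push psi0 => [|n] Phi _ _ psi psiE psi_alt psi_push psi0.
  apply: val_inj; apply: dprodP => x; rewrite /= dprod0E.
  rewrite -[LHS](push_id (X := X)) -psiE // /diff big1 // => i _.
  by rewrite psi0 ?mul0rz.
(* Each value is taken at the level where it must live; [psi_push] reconciles the levels of the
   faces. *)
pose Psi : cochain X n := fun x => psi (meets x) x.
have altPsi : Psi \in @alternating _ _ X n.
  apply/alternatingP => x s; rewrite /Psi -psi_alt -pushE psi_push ?meets_comp //.
  exact: meets_le.
exists (AltCochain altPsi); apply: val_inj; apply: dprodP => x.
rewrite /= -[LHS](push_id (X := X)) -psiE //; apply: eq_bigr => i _.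
rewrite -pushE psi_push ?meets_comp //; exact: meets_le.
Qed.
End SystemPrism.

Section SumSystemPrism.
Variables (G : Omega_system) (b : nat -> forall k, ('I_k.+1 -> Omega) -> Omega).
Hypothesis b_sym : forall i k (x : 'I_k.+1 -> Omega) (s : 'S_k.+1),
  b i (x \o s) = b i x.
Hypothesis le_b : forall i k (y : 'I_k.+1 -> Omega), (meets y i <= b i y i)%N.
(* Without this, the primitive built coordinate by coordinate need not have
   finite support. *)
Hypothesis b_stable : exists N, forall i, (N <= i)%N -> b i = b N.

Lemma le_meets_coordP i k (y : 'I_k.+1 -> Omega) (m : nat) :
  (m <= meets y i)%O <-> all_in (fun t : Omega => m <= t i)%O y.
Proof. by rewrite meets_at_coordE; exact: le_meetsP. Qed.

(** Differentials, signs and bonding maps act coordinatewise, so each coordinate may use its own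
    barycenters. *)
Lemma coboundary_of_subdiv_sum n (Phi : alt_cochain (sum_system G) n) :
  alt_diff Phi = 0 ->
  (forall i x t, barycentric (b i) x t -> dsum_fun (alt_val Phi t) i = 0) ->
  is_coboundary Phi.
Proof.
move=> dPhi Phi0.
pose phi i (y : 'I_n.+1 -> Omega) : G i (meets y i) := dsum_fun (alt_val Phi y) i.
pose psi i (m : nat) := @local_prism _ _ Omega nat (G i)
  (fun k (y : 'I_k.+1 -> Omega) => meets y i) (b i) n (phi i) m.
have psiE i (m : nat) (x : 'I_n.+1 -> Omega) : (m <= meets x i)%O -> 
    diff (psi i m) x = push m (dsum_fun (alt_val Phi x) i).
  apply: (@local_prism_diff _ _ _ _ _ (fun t : Omega => t i) _
           (@le_meets_coordP i) _ (le_b i)) => [y my|t]; last exact: Phi0.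
  transitivity (push m (dsum_fun (alt_val (alt_diff Phi) y) i)).
    rewrite /= /cochain_diff dsum_sumE raddf_sum; apply: eq_bigr => j _.
    by rewrite dsumMzE raddfMz /= push_bond.
  by rewrite dPhi; exact: raddf0.
have psi_alt i (m : nat) : alternates (psi i m).
  apply: (@local_prism_alternates _ _ _ _ _ (fun t : Omega => t i) _
           (@le_meets_coordP i)) => // y s my.
  have /alternatingP/(_ y s) := alt_valP Phi.
  move/(congr1 (fun a : dsum _ => dsum_fun a i)); rewrite dsumMzE /= => <-.
  by rewrite push_bond.
have psi_push i (m l : nat) x : (m <= l)%O ->
    all_in (fun t : Omega => l <= t i)%O x -> push m (psi i l x) = psi i m x.
  exact: (@push_local_prism _ _ _ _ _ (fun t : Omega => t i) _
           (@le_meets_coordP i) _ (le_b i)).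
(* From [N] on all coordinates share the barycenters [b N], and [Phi] has finite support at each
   tuple, so [prism_eventually0] applies. *)
have psi_fin (m : nat -> nat) x :
    ((fun i => psi i (m i) x) : dprod (fun i => G i (m i))) \in
      finsupp (fun i => G i (m i)).
  have [N bN] := b_stable.
  have [|K fK] := @prism_eventually0 _ Omega (b N) (fun i => G i (m i)) n
    (fun i (t : 'I_n.+1 -> Omega) => push (m i) (phi i t)) x.
    move=> t; have /finsuppP /finite_seqP [s sE] := dsum_valP (alt_val Phi t).
    exists (\max_(j <- s) j).+1 => i lti; apply/eqP/negP => nz.
    have : (i \in s).
      suff : [set` s]%classic i by [].
      rewrite -sE /=; apply/eqP => z; apply/nz/eqP.
      by rewrite /phi /dsum_fun z raddf0.
    by move=> si; move: lti; rewrite ltnNge (leq_bigmax_seq (F := id) i si).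
  apply/finsuppP; apply: (sub_finite_set _ (finite_II (maxn N K))) => i /=.
  apply: contraNT; rewrite -leqNgt geq_max => /andP[Ni Ki].
  by rewrite /psi /local_prism bN // fK.
have psi0 i m x : n = 0%N -> psi i m x = 0 by move=> n0; subst n.
clearbody psi; clear phi; case: n Phi {dPhi Phi0} psi psiE psi_alt psi_push psi_fin psi0
  => [|n] Phi psi psiE psi_alt psi_push psi_fin psi0.
  apply: val_inj; apply: dprodP => x; apply: dsumP => i.
  transitivity (diff (psi i (meets x i)) x); first by rewrite psiE // push_id.
  rewrite /diff big1 // => j _.
  by rewrite psi0 ?mul0rz.
pose Psi : cochain (sum_system G) n := fun x : 'I_n.+1 -> Omega =>
  DSum (psi_fin (fun i => meets x i) x).
have altPsi : Psi \in @alternating _ _ (sum_system G) n.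
  apply/alternatingP => x s; apply: dsumP => i; rewrite dsumMzE /= -psi_alt -pushE.
  by apply: psi_push; [exact: Omega_le_at (meets_comp _ _) _ | apply/le_meets_coordP].
exists (AltCochain altPsi); apply: val_inj; apply: dprodP => x; apply: dsumP => i.
transitivity (diff (psi i (meets x i)) x); first by rewrite psiE // push_id.
rewrite /= /cochain_diff dsum_sumE.
apply: eq_bigr => j _; rewrite dsumMzE /= -pushE psi_push //.
  exact: Omega_le_at (meets_comp _ _) _.
by apply/le_meets_coordP.
Qed.

End SumSystemPrism.

(** * Restriction to one coordinate *)

Fact bump_from_subproof (i k : nat) :
  (fun j => if (i <= j)%N then (j + (k - i))%N else j) \in strictly_increasing.
Proof.
apply/strictly_increasingP => j l jl; case: (leqP i j) => ij.
  by case: ifP => il; lia.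
by case: ifP => il; lia.
Qed.

(* A strictly increasing function has value at least [i] at [i], so [maxn k i]
   is as close to [k] as the value at [i] can be. *)
Definition bump_from i k : Omega := MkOmega (bump_from_subproof i k).

Lemma bump_fromE i k : bump_from i k i = maxn k i.
Proof. by rewrite /= leqnn -maxnE maxnC. Qed.

Lemma bump_from_max i k : bump_from i (maxn k i) = bump_from i k.
Proof.
apply: val_inj; apply/funext => j /=; congr (if _ then (_ + _)%N else _).
lia.
Qed.

Section CoordinateRestriction.
Variables (G : Omega_system) (i n : nat).

(** Pullback along [bump_from i]. Since [maxn k i >= k], the value found lies at a level above
    [meets k] and is pushed down. *)
Definition restrict_cochain (Phi : cochain (sum_system G) n) : cochain (G i) n :=
  fun k => push (meets k) (dsum_fun (Phi (bump_from i \o k)) i).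

Lemma le_meets_bump_from m (k : 'I_m.+1 -> nat) :
  (meets k <= meets (bump_from i \o k) i)%O.
Proof.
rewrite meets_at_coordE; apply: le_meets => j; rewrite /at_coord /= leqnn.
by apply: le_trans (meets_le k j) _; rewrite leEnat; lia.
Qed.

Fact restrict_alt_subproof (Phi : alt_cochain (sum_system G) n) :
  restrict_cochain Phi \in @alternating _ _ (G i) n.
Proof.
apply/alternatingP => k s.
have /alternatingP/(_ (bump_from i \o k) s) := alt_valP Phi.
move/(congr1 (fun a : dsum _ => dsum_fun a i)); rewrite dsumMzE /= => E.
rewrite /restrict_cochain -raddfMz /= -[X in push (meets k) X]E -pushE push_push //.
- by rewrite push_bond ?le_meets_bump_from.
- exact: meets_comp.
- exact: (le_meets_bump_from (k \o s)).
Qed.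

Definition restrict_alt (Phi : alt_cochain (sum_system G) n) :
  alt_cochain (G i) n := AltCochain (restrict_alt_subproof Phi).

Fact restrict_alt_is_zmod_morphism : zmod_morphism restrict_alt.
Proof.
move=> Phi Psi; apply: val_inj; apply: dprodP => k; rewrite [RHS]dprodBE.
by rewrite /= /restrict_cochain -raddfB.
Qed.
HB.instance Definition _ := GRing.isZmodMorphism.Build
  (alt_cochain (sum_system G) n) (alt_cochain (G i) n)
  restrict_alt restrict_alt_is_zmod_morphism.

(** Restriction after inclusion is pullback along [k |-> maxn k i]: the identity on tuples with
    entries at least [i], but not in general. *)
Lemma restrict_incl (z : alt_cochain (G i) n) k :
  alt_val (restrict_alt (incl_alt z)) k =
    push (meets k) (alt_val z (at_coord (bump_from i \o k) i)).
Proof.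
have := @dsum_in_id (fun l => G l (meets (bump_from i \o k) l)) i
  (bond (G i) (meets_at_coord (bump_from i \o k) i)
    (alt_val z (at_coord (bump_from i \o k) i))).
move/(congr1 (@push _ _ (G i) (meets k) _)) => E; rewrite [LHS]E.
by rewrite push_bond ?le_meets_bump_from.
Qed.

Lemma restrict_incl_neq j (z : alt_cochain (G j) n) :
  j != i -> restrict_alt (incl_alt z) = 0.
Proof.
move=> ji; apply: val_inj; apply: dprodP => k.
have := @dsum_in_neq (fun l => G l (meets (bump_from i \o k) l)) j i
  (bond (G j) (meets_at_coord (bump_from i \o k) j)
    (alt_val z (at_coord (bump_from i \o k) j))) ji.
move/(congr1 (@push _ _ (G i) (meets k) _)) => E; rewrite [LHS]E.
exact: raddf0.
Qed.

End CoordinateRestriction.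

Lemma restrict_alt_diff (G : Omega_system) i n (Phi : alt_cochain (sum_system G) n) :
  alt_diff (restrict_alt i Phi) = restrict_alt i (alt_diff Phi).
Proof.
apply: val_inj; apply: dprodP => k.
rewrite /= /cochain_diff /restrict_cochain dsum_sumE raddf_sum.
apply: eq_bigr => j _; rewrite dsumMzE raddfMz /= -pushE; congr (_ *~ _).
rewrite push_bond ?le_meets_bump_from // push_push ?meets_comp //.
exact: (le_meets_bump_from i (k \o lift j)).
Qed.

Lemma restrict_coboundary (G : Omega_system) i n (Phi : alt_cochain (sum_system G) n) :
  is_coboundary Phi -> is_coboundary (restrict_alt i Phi).
Proof.
case: n Phi => [|n] Phi /= => [->|[Psi ->]]; first exact: raddf0.
by exists (restrict_alt i Psi); rewrite restrict_alt_diff.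
Qed.

Lemma is_coboundaryD d (P : meetSemilatticeType d) (X : inverse_system P) n
    (Phi Psi : alt_cochain X n) :
  is_coboundary Phi -> is_coboundary Psi -> is_coboundary (Phi + Psi).
Proof.
case: n Phi Psi => [|n] Phi Psi /= => [-> ->|[A ->] [B ->]]; first by rewrite addr0.
by exists (A + B); rewrite raddfD.
Qed.

Lemma meets_perm d (P : meetSemilatticeType d) k (x : 'I_k.+1 -> P) (s : 'S_k.+1) :
  meets (x \o s) = meets x.
Proof.
apply: le_anti; rewrite meets_comp andbT; apply: le_meets => j.
by have := meets_le (x \o s) (s^-1%g j); rewrite /= permKV.
Qed.

(** The barycenters [maxn (meets k) i] are at least [i], so [z] vanishes on all subdivisions. *)
Lemma coboundary_vanishing_above (X : inverse_system nat) i n (z : alt_cochain X n) :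
  alt_diff z = 0 -> (forall k, all_in (leq i) k -> alt_val z k = 0) ->
  is_coboundary z.
Proof.
move=> dz z0.
apply: (@coboundary_of_subdiv _ _ X (fun m k => maxn (meets k) i)) => //.
- by move=> m x s; rewrite meets_perm.
- by move=> m y; rewrite leEnat leq_maxl.
- by move=> x t /barycentric_in ?; apply: z0; auto using leq_maxr.
Qed.

(** [z] and its restricted inclusion agree on tuples with entries at least [i], hence differ by a
    coboundary. *)
Lemma restrict_incl_coboundary (G : Omega_system) i n (z : cocycle (G i) n) :
  is_coboundary (restrict_alt i (incl_alt z)) -> is_coboundary z.
Proof.
move=> Bz; have dz : alt_diff z = 0 by exact/cocyclesP/cocycle_valP.
rewrite -[cocycle_val z](subrK (restrict_alt i (incl_alt z))).
apply: is_coboundaryD => //; apply: (@coboundary_vanishing_above _ i).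
  rewrite raddfB /= restrict_alt_diff incl_alt_diff dz.
  by rewrite !raddf0 addr0.
move=> k ik; transitivity (alt_val z k - alt_val (restrict_alt i (incl_alt z)) k) => //.
have kE : at_coord (bump_from i \o k) i = k.
  by apply/funext => j; rewrite /at_coord [LHS]bump_fromE; apply/maxn_idPl/ik.
by rewrite restrict_incl kE push_id subrr.
Qed.

(** * Injectivity of the inclusion map *)

Section InclusionMap.
Variables (G : Omega_system) (n : nat).

Lemma derlim_class_eq0 d (P : meetSemilatticeType d) (X : inverse_system P)
    (z : cocycle X n) : derlim_class z = 0 <-> is_coboundary z.
Proof.
rewrite -(raddf0 (@derlim_class _ _ X n)); split.
  by move=> /derlim_class_eqP; rewrite subr0 => /coboundariesP.
by move=> Bz; apply/derlim_class_eqP; rewrite subr0; apply/coboundariesP.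
Qed.

Lemma cocycle_val_sum d (P : meetSemilatticeType d) (X : inverse_system P)
    (I : Type) (r : seq I) (z : I -> cocycle X n) :
  cocycle_val (\sum_(i <- r) z i) = \sum_(i <- r) cocycle_val (z i).
Proof. exact: (raddf_sum (val : {additive cocycle X n -> alt_cochain X n})). Qed.

Lemma finsupp_bound (A : nat -> zmodType) (u : dsum A) :
  exists N, forall i, (N <= i)%N -> u i = 0.
Proof.
have /finsuppP /finite_seqP [s sE] := dsum_valP u.
exists (\max_(j <- s) j).+1 => i lti; apply/eqP/negP => nz.
have si : i \in s.
  suff : [set` s]%classic i by [].
  by rewrite -sE /=; apply/negP.
by move: lti; rewrite ltnNge (leq_bigmax_seq (F := id) i si).
Qed.

(** Restriction to coordinate [i] kills every summand but the [i]-th. *)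
Lemma inclusion_map_inj : injective (inclusion_map (G := G) (n := n)).
Proof.
apply: raddf_inj => u u0; apply: dsumP => i.
have [N uN] := finsupp_bound u; pose M := maxn N i.+1.
have iM : (i < M)%N by rewrite leq_maxr.
have {u0} : inclusion_map u = 0 := u0.
rewrite (@inclusion_map_widen _ _ _ `I_M) //; last first.
  move=> j; apply: contraNT; rewrite /= -leqNgt geq_max => /andP[Nj _].
  by rewrite uN.
rewrite -fsbig_ord /incl_derlim -raddf_sum => /derlim_class_eq0.
rewrite cocycle_val_sum => /(restrict_coboundary i).
rewrite raddf_sum (bigD1 (Ordinal iM)) //= big1 ?addr0 => [|j ji]; last first.
  by apply: restrict_incl_neq; rewrite -val_eqE in ji.
by move/restrict_incl_coboundary/derlim_class_eq0; rewrite derlim_reprK.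
Qed.

End InclusionMap.

(** * Barycenters from the partition hypothesis *)

(* Any linear order would do: sorting tuples makes the barycenters symmetric. *)
Definition lex_le (x y : Omega) : bool :=
  `[< x = y \/ exists i, (forall j, (j < i)%N -> x j = y j) /\ (x i < y i)%N >].

Lemma lex_le_total : total lex_le.
Proof.
move=> x y; apply/orP; have [xy|xy] := pselect (exists i, x i != y i); last first.
  left; apply/asboolP; left; apply/val_inj/funext => i.
  by apply/eqP/negPn/negP => xyi; apply: xy; exists i.
case: (ex_minnP xy) => i xyi min_i.
have eq_lt j : (j < i)%N -> x j = y j.
  by move=> ji; apply/eqP/negPn/negP => /min_i; rewrite leqNgt ji.
move: xyi; rewrite neq_ltn => /orP[xyi|yxi]; [left|right]; apply/asboolP; right.
  by exists i.
by exists i; split=> // j /eq_lt.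
Qed.

Lemma lex_le_trans : transitive lex_le.
Proof.
move=> y x z /asboolP[->//|[i [xy xyi]]] /asboolP[<-|[j [yz yzj]]]; apply/asboolP.
  by right; exists i.
right; have [ij|ji|ij] := ltngtP i j.
- exists i; split=> [l li|]; first by rewrite xy // yz // (ltn_trans li).
  by rewrite -yz.
- exists j; split=> [l lj|]; first by rewrite xy ?yz // (ltn_trans lj).
  by rewrite xy.
- exists i; split=> [l li|]; first by rewrite xy // yz // -ij.
  by rewrite (ltn_trans xyi) // ij.
Qed.

Lemma lex_le_anti : antisymmetric lex_le.
Proof.
move=> x y /andP[/asboolP[//|[i [xy xyi]]] /asboolP[->//|[j [yx yxj]]]].
have [ij|ji|ij] := ltngtP i j.
- by move: xyi; rewrite yx // ltnn.
- by move: yxj; rewrite xy // ltnn.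
- by move: xyi; rewrite ij ltnNge ltnW.
Qed.

Definition tuple_seq k (x : 'I_k -> Omega) : seq Omega :=
  sort lex_le [seq x j | j <- enum 'I_k].

Lemma size_tuple_seq k (x : 'I_k -> Omega) : size (tuple_seq x) = k.
Proof. by rewrite size_sort size_map size_enum_ord. Qed.

Lemma tuple_seq_perm k (x : 'I_k -> Omega) (s : 'S_k) :
  tuple_seq (x \o s) = tuple_seq x.
Proof.
apply/(perm_sortP lex_le_total lex_le_trans lex_le_anti).
rewrite (map_comp x s); apply: (perm_map x); apply: uniq_perm.
- by rewrite map_inj_uniq ?enum_uniq //; exact: perm_inj.
- exact: enum_uniq.
- move=> j; rewrite mem_enum; apply/mapP; exists (s^-1%g j); last by rewrite permKV.
  exact: mem_enum.
Qed.

(** Sorting turns the faces of a tuple into sublists, from which the chains fed to [F] are built. *)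
Lemma tuple_seq_lift k (x : 'I_k.+1 -> Omega) j :
  subseq (tuple_seq (x \o lift j)) (tuple_seq x).
Proof.
have -> : tuple_seq x = sort lex_le (x j :: [seq (x \o lift j) i | i <- enum 'I_k]).
  apply/(perm_sortP lex_le_total lex_le_trans lex_le_anti).
  rewrite (map_comp x (lift j)); apply: (@perm_map _ _ x _ (j :: _)); apply: uniq_perm.
  - exact: enum_uniq.
  - rewrite /= map_inj_uniq ?enum_uniq //; last exact: lift_inj.
    by rewrite andbT; apply/mapP => -[i _ E]; have := neq_lift j i; rewrite -E eqxx.
  - move=> i; rewrite mem_enum inE in_cons; case: (unliftP j i) => [i' ->|->].
      by symmetry; apply/orP; right; apply: (map_f (lift j)); rewrite mem_enum.
    by rewrite eqxx.
exact/(subseq_sort lex_le_total lex_le_trans)/subseq_cons.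
Qed.

Lemma mem_tuple_seq k (x : 'I_k -> Omega) a :
  a \in tuple_seq x -> exists j, a = x j.
Proof. by rewrite mem_sort => /mapP[j _ ->]; exists j. Qed.

(* Diagonalization: a strictly increasing [z] with [x_ k <= z] from [k] on. *)
Lemma le_from_cofinal (Y : nat -> Omega -> Prop) : (forall x, exists k, Y k x) ->
  exists k, forall x, exists y, Y k y /\ le_from k x y.
Proof.
move=> Ycover; apply: contrapT => noY.
have /choice [x_ x_P] : forall k, exists x, forall y, Y k y -> ~ le_from k x y.
  move=> k; apply: contrapT => nox; apply: noY; exists k => x.
  apply: contrapT => noy; apply: nox; exists x => y Yy xy.
  by apply: noy; exists y.
have z_incr : (fun i => \max_(k < i.+1) x_ k i)%N \in strictly_increasing.
  apply/strictly_increasingP => i j ij.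
  have [|k ->] := bigop.eq_bigmax (fun k : 'I_i.+1 => x_ k i); first by rewrite card_ord.
  have kj : (k < j.+1)%N by have := ltn_ord k; lia.
  apply: leq_trans (leq_bigmax (F := fun k : 'I_j.+1 => x_ k j) (Ordinal kj)).
  by have /strictly_increasingP := omega_incr (x_ k); exact.
have [k Yk] := Ycover (MkOmega z_incr).
apply: (x_P _ _ Yk) => i ki /=; rewrite -ltnS in ki.
exact: (leq_bigmax (F := fun k : 'I_i.+1 => x_ k i) (Ordinal ki)).
Qed.

Section PartitionHypothesis.
Variables (n : nat) (F : Omega_upto n.+1 -> Omega).

(** Lists too long for [F] are sent to their head, so that barycenters of tuples of every length
    stay above the meet from a common stage on. *)
Definition on_seq (s : seq Omega) : Omega :=
  if decP (@idP (0 < size s <= n.+1)%N) is left h then F (OmegaUpto h)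
  else head (bump_from 0 0) s.

Lemma on_seqE (u : Omega_upto n.+1) : on_seq u = F u.
Proof.
case: u => s h; rewrite /on_seq /=; case: decP => // h'.
by rewrite (bool_irrelevance h' h).
Qed.

Lemma on_seq_long s : (n.+1 < size s)%N -> on_seq s = head (bump_from 0 0) s.
Proof.
rewrite ltnNge => /negP long; rewrite /on_seq; case: decP => // h.
by case: long; case/andP: h.
Qed.

Lemma chain_of_seqs (tau : nat -> seq Omega) :
  (forall l, (l <= n.+1)%N -> size (tau l) = l) ->
  (forall l, (l < n.+1)%N -> subseq (tau l) (tau l.+1)) ->
  exists sigma : Omega_chain n.+1, forall i, star F sigma i = on_seq (tau i.+1).
Proof.
move=> size_tau sub_tau.
have ok (i : 'I_n.+1) : (0 < size (tau i.+1) <= n.+1)%N by rewrite size_tau /=.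
have sizeP (i : 'I_n.+1) : size (OmegaUpto (ok i)) = i.+1 by rewrite /= size_tau.
have subP (i j : 'I_n.+1) : j = i.+1 :> nat ->
    subseq (OmegaUpto (ok i)) (OmegaUpto (ok j)).
  by move=> ji /=; rewrite ji; apply: sub_tau; rewrite -ji.
exists (OmegaChain sizeP subP) => i.
by rewrite /star -on_seqE.
Qed.

Lemma star_le_star (sigma : Omega_chain n.+1) : cofinal F ->
  exists k, forall i j : 'I_n.+1, j = i.+1 :> nat ->
    le_from k (star F sigma i) (star F sigma j).
Proof.
move=> [_ F_mono].
have /choice [K KP] : forall i : 'I_n.+1, exists k, forall j : 'I_n.+1,
    j = i.+1 :> nat -> le_from k (star F sigma i) (star F sigma j).
  move=> i; have [in_|] := ltnP i.+1 n.+1; last first.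
    by move=> ni; exists 0 => j ji; have := ltn_ord j; rewrite ji ltnNge ni.
  have [k Fk] := F_mono _ _ (@chain_subseq _ sigma i (Ordinal in_) erefl).
  by exists k => j ji; rewrite (_ : j = Ordinal in_) //; exact: val_inj.
exists (\max_i K i) => i j ji l Kl; apply: (KP i j ji).
exact: leq_trans (leq_bigmax i) Kl.
Qed.

End PartitionHypothesis.

(** The barycenter of [x] is [F] at the sorted list of the [g (x j)], where [g] enlarges each
    function to one that [F] dominates from a uniform stage on. *)
Lemma PH_barycenters n (bound : ('I_n.+1 -> Omega) -> nat) : PH n ->
  exists N (b : forall k, ('I_k.+1 -> Omega) -> Omega),
  [/\ forall k (x : 'I_k.+1 -> Omega) (s : 'S_k.+1), b k (x \o s) = b k x,
      forall k (y : 'I_k.+1 -> Omega) i, (N <= i)%N -> (meets y i <= b k y i)%N &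
      forall x t : 'I_n.+1 -> Omega, barycentric b x t -> (bound t <= N)%N].
Proof.
move=> hPH.
(* [K y] is a stage from which [y] is increasing, or 0 if there is none; for the tuples
   [star F sigma] there always is one. *)
pose Q (y : 'I_n.+1 -> Omega) k :=
  forall i j : 'I_n.+1, j = i.+1 :> nat -> le_from k (y i) (y j).
have /choice [K KP] : forall y, exists k, (exists k', Q y k') -> Q y k.
  move=> y; have [[k Qk]|noQ] := pselect (exists k', Q y k').
    by exists k.
  by exists 0.
(* [barycentric] lists the larger faces first, hence [rev_ord]. *)
have [F F_cof [N1 FN1]] := hPH (fun y => maxn (bound (y \o @rev_ord n.+1)) (K y)).
have bound_star sigma : (bound (star F sigma \o @rev_ord n.+1) <= N1)%N.
  by rewrite -(FN1 sigma) leq_maxl.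
have star_mono sigma : Q (star F sigma) N1.
  move=> i j ji l N1l; apply: (KP _ (star_le_star sigma F_cof) i j ji).
  by apply: leq_trans N1l; rewrite -(FN1 sigma) leq_maxr.
(* Diagonalization makes the stage uniform: [x <= g x <= F [:: g x]] from [N2] on, for all [x]. *)
have [|N2 /choice [g gP]] := @le_from_cofinal (fun k y => le_from k y (on_seq F [:: y])).
  move=> y; have [k yk] := F_cof.1 y; exists k.
  by rewrite -(on_seqE F (upto1 n y)) in yk.
have head_le a s : (size s <= n)%N -> le_from N1 (on_seq F [:: a]) (on_seq F (a :: s)).
  move=> s_n.
  (* Prefixes of [a :: s], padded by copies of [a] to length at least [n.+1], form a chain from
     [[:: a]] through [a :: s]. *)
  have [|l _|sigma sigmaP] := @chain_of_seqs n F
      (fun l => take l ((a :: s) ++ nseq n.+1 a)).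
  - move=> l ln; rewrite size_takel // size_cat size_nseq /=; lia.
  - by apply: (@subseq_trans _ (take l.+1 ((a :: s) ++ nseq n.+1 a))) => //;
      rewrite -[X in subseq X](take_takel _ (leqnSn l)) take_subseq.
  have step l (ln : (l < n.+1)%N) :
      le_from N1 (on_seq F [:: a]) (star F sigma (Ordinal ln)).
    elim: l ln => [|l IHl] ln i Ni; first by rewrite sigmaP /= take0.
    apply: leq_trans (IHl (ltnW ln) i Ni) _.
    exact: (star_mono sigma (Ordinal (ltnW ln)) (Ordinal ln) erefl).
  have sn : (size s < n.+1)%N by [].
  by move: (step _ sn); rewrite sigmaP take_cat /= ltnn subnn take0 cats0.
pose b k (x : 'I_k.+1 -> Omega) := on_seq F (tuple_seq (g \o x)).
exists (maxn N1 N2), b; split=> [k x s|k y i|x t].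
- by rewrite /b -(tuple_seq_perm (g \o x) s).
- rewrite geq_max => /andP[N1i N2i]; rewrite /b.
  (* The head [a] is some [g (y j)], and [meets y <= y j <= a <= F [:: a] <= F (a :: s)] holds at
     [i]. *)
  have := size_tuple_seq (g \o y); have := @mem_tuple_seq _ (g \o y).
  case: (tuple_seq _) => // a s /(_ a) []; first exact: mem_head.
  move=> j aE [sk]; have [gy yg] := gP (y j).
  apply: leq_trans (Omega_le_at (meets_le y j) i) _.
  apply: leq_trans (yg i N2i) _; rewrite -[g (y j)]aE.
  have [ns|sn] := ltnP n (size s); first by rewrite on_seq_long.
  by apply: leq_trans (head_le a s sn i N1i); rewrite aE; exact: gy.
(* A barycentric tuple comes from a flag of faces of [x']; [tau l] is the sorted image under [g] of
   the face of length [l]. *)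
- suff chainP k (x' t' : 'I_k -> Omega) : barycentric b x' t' ->
    exists tau : nat -> seq Omega,
      [/\ forall l, (l <= k)%N -> size (tau l) = l,
          forall l, (l < k)%N -> subseq (tau l) (tau l.+1),
          tau k = tuple_seq (g \o x') &
          forall j, t' j = on_seq F (tau (k - j)%N)].
    move=> /chainP [tau [size_tau sub_tau _ tE]].
    have [sigma sigmaP] := @chain_of_seqs n F tau size_tau sub_tau.
    apply: leq_trans (leq_maxl _ _); apply: leq_trans (bound_star sigma).
    rewrite (_ : t = star F sigma \o @rev_ord n.+1) //; apply/funext => j.
    by rewrite tE /= sigmaP /= subSS -subSn // -ltnS.
  elim: k x' t' => [|k IHk] x' t' /=.
    move=> _; exists (fun=> [::]); split=> //; last by case.
      by case.
    by apply/esym/size0nil; rewrite size_tuple_seq.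
  move=> [j [u [/IHk[tau [size_tau sub_tau tau_k tE]] ->]]].
  exists (fun l => if (l <= k)%N then tau l else tuple_seq (g \o x')); split.
  + move=> l lk; case: ifP => [|kl]; first exact: size_tau.
    by rewrite size_tuple_seq; lia.
  + move=> l lk; rewrite -ltnS lk; have [lk'|kl] := ltnP l k; first exact: sub_tau.
    have -> : l = k by lia.
    by rewrite tau_k; exact: tuple_seq_lift.
  + by rewrite ltnn.
  + move=> i; rewrite /fcons; case: (unliftP ord0 i) => [i' ->|->]; last first.
      by rewrite subn0 ltnn.
    by rewrite /= /bump /= add1n subSS leq_subr tE.
Qed.

(** * Surjectivity *)

Section Surjectivity.
Variables (G : Omega_system) (n : nat).

Lemma incl_coordE i (z : alt_cochain (G i) n) (t : 'I_n.+1 -> Omega) :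
  dsum_fun (alt_val (incl_alt z) t) i =
    push (meets t i) (alt_val z (at_coord t i)).
Proof. by rewrite (pushE (meets_at_coord t i)); exact: (@dsum_in_id (fun l => G l (meets t l))). Qed.

Lemma incl_coord_neq i j (z : alt_cochain (G j) n) (t : 'I_n.+1 -> Omega) :
  j != i -> dsum_fun (alt_val (incl_alt z) t) i = 0.
Proof. exact: (@dsum_in_neq (fun l => G l (meets t l))). Qed.

Lemma sum_coordE N (z : 'I_N -> alt_cochain (sum_system G) n)
    (t : 'I_n.+1 -> Omega) i :
  dsum_fun (alt_val (\sum_(j < N) z j) t) i =
    \sum_(j < N) dsum_fun (alt_val (z j) t) i.
Proof. by elim/big_rec2: _ => // j a Z _ <-. Qed.

(** Such a tuple is recovered from its values at [i], so pulling back along [bump_from i] loses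
    nothing there. *)
Lemma restrict_fixed i (Phi : alt_cochain (sum_system G) n) t :
  all_in (fun y : Omega => bump_from i (y i) = y) t ->
  dsum_fun (alt_val (incl_alt (restrict_alt i Phi)) t) i =
    dsum_fun (alt_val Phi t) i.
Proof.
move=> t_fixed; rewrite incl_coordE /= /restrict_cochain push_push.
- have -> : bump_from i \o at_coord t i = t by apply/funext => j; exact: t_fixed.
  exact: push_id.
- exact: meets_at_coord.
- exact: le_meets_bump_from.
Qed.

Fact restrict_cocycle_subproof i (z : cocycle (sum_system G) n) :
  restrict_alt i z \in @cocycles _ _ (G i) n.
Proof.
apply/cocyclesP; rewrite restrict_alt_diff (cocyclesP _ (cocycle_valP z)).
exact: raddf0.
Qed.

Definition restrict_cocycle i (z : cocycle (sum_system G) n) : cocycle (G i) n :=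
  Cocycle (restrict_cocycle_subproof i z).

Lemma finitely_many_coordinates (z : cocycle (sum_system G) n) : PH n ->
  exists N, is_coboundary
    (cocycle_val (z - \sum_(i < N) incl_cocycle (restrict_cocycle i z))).
Proof.
move=> hPH.
have /choice [bound boundP] : forall t, exists M, forall i, (M <= i)%N ->
    dsum_fun (alt_val (cocycle_val z) t) i = 0.
  by move=> t; exact: finsupp_bound.
have [N [b0 [b0_sym le_b0 b0_bound]]] := PH_barycenters bound hPH.
exists N; set w := z - _.
have wE t i : dsum_fun (alt_val (cocycle_val w) t) i =
    dsum_fun (alt_val (cocycle_val z) t) i -
    \sum_(j < N) dsum_fun (alt_val (incl_alt (restrict_alt j z)) t) i.
  by rewrite -sum_coordE -(cocycle_val_sum _ (fun j : 'I_N => incl_cocycle (restrict_cocycle j z))).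
(* For [i < N] the barycenters are values of [bump_from i], where the subtracted cocycle cancels
   coordinate [i] of [z]; the other coordinates use those from [PH]. *)
pose b i k (x : 'I_k.+1 -> Omega) :=
  if (i < N)%N then bump_from i (meets x i) else b0 k x.
apply: (@coboundary_of_subdiv_sum G b).
- by move=> i k x s; rewrite /b meets_perm b0_sym.
- move=> i k y; rewrite /b; case: ltnP => [_|Ni]; last exact: le_b0.
  by rewrite bump_fromE leq_maxl.
- by exists N => i Ni; rewrite /b ltnn ltnNge Ni.
- exact/cocyclesP/cocycle_valP.
- move=> i x t; rewrite wE => xt; have [iN|Ni] := ltnP i N.
    have t_fixed : all_in (fun y : Omega => bump_from i (y i) = y) t.
      apply: barycentric_in xt => k y.
      by rewrite /b iN bump_fromE bump_from_max.
    rewrite (bigD1 (Ordinal iN)) // big1 => [|j ji]; last first.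
      by apply: incl_coord_neq; rewrite -val_eqE in ji.
    by rewrite [X in _ - X]addr0 [X in _ - X](restrict_fixed z t_fixed) subrr.
  have bE : b i = b0.
    by apply: functional_extensionality_dep => k; apply/funext => y; rewrite /b ltnNge Ni.
  (* On barycentric tuples the support of [z] lies below [N <= i], and the subtracted cocycles live
     at coordinates below [N]. *)
  rewrite bE in xt; rewrite boundP ?sub0r; last exact: leq_trans (b0_bound _ _ xt) Ni.
  rewrite big1 ?oppr0 // => j _; apply: incl_coord_neq.
  by rewrite neq_ltn (leq_trans (ltn_ord j) Ni).
Qed.

Lemma inclusion_map_surj : PH n ->
  forall w, exists u, inclusion_map (G := G) (n := n) u = w.
Proof.
move=> hPH w; have [N Bw] := finitely_many_coordinates (derlim_repr w) hPH.
pose z i := restrict_cocycle i (derlim_repr w).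
exists (\sum_(i < N) @dsum_in (fun i => derlim (G i) n) i (derlim_class (z i))).
rewrite raddf_sum /= -[RHS]derlim_reprK.
under eq_bigr do rewrite inclusion_map_in incl_derlim_class.
rewrite -raddf_sum; apply/esym/derlim_class_eqP/coboundariesP; exact: Bw.
Qed.

End Surjectivity.

Theorem theorem7p5 (n : nat) (hPH : PH n) (G : Omega_system) :
  bijective
    (inclusion_map (G := G) (n := n) :
       {additive dsum (fun i => derlim (G i) n) -> derlim (sum_system G) n}).
Proof.
have /choice [f fK] := inclusion_map_surj (G := G) hPH.
by exists f => [u|w]; [apply: inclusion_map_inj; exact: fK | exact: fK].
Qed.
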